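(* A stack can be implemented on a pointer machine such that the operations $\mathrm{PUSH}(x)$ and $\mathrm{POP}()$ take $O(1)$ worst-case time and the operation $\mathrm{MULTIPOP}(k)$ takes $O(\min\{k,\log n\})$ worst-case time, where $n$ is the current number of elements in the stack; moreover all these operations take $O(1)$ amortized time.
   Context: A stack supports: $\mathrm{PUSH}(x)$, which inserts element $x$ on top of the stack; $\mathrm{POP}()$, which deletes the top element if the stack is nonempty; and $\mathrm{MULTIPOP}(k)$, which deletes the $k$ topmost elements, or all elements if the stack has fewer than $k$ elements. *)

(* Defs.v *)
From mathcomp Require Import all_boot.

Set Implicit Arguments.
Unset Strict Implicit.
Unset Printing Implicit Defensive.

(** * Pointer machine

    Memory is a set of nodes; a node has pointer fields, word fields and
    element fields, and so has the register file.  Registers and fields are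
    numbered by [nat], but every instruction names them by literals, so a given
    (finite) program uses only a constant number of registers and of fields per
    node.  Node addresses are opaque: the only way to obtain a pointer is to
    create a node or to copy an existing pointer, and pointers can only be
    compared for equality and dereferenced.  The elements, of an arbitrary type
    [T], can only be copied.  Arithmetic exists on words only. *)

Record node (T : Type) := Node {
  pfld : nat -> option nat;  (* [None] is the nil pointer *)
  wfld : nat -> nat;
  efld : nat -> option T     (* [None] is "no element" *)
}.

Record config (T : Type) := Config {
  preg : nat -> option nat;
  wreg : nat -> nat;
  ereg : nat -> option T;
  heap : nat -> node T;
  fresh : nat                (* the addresses in use are those below [fresh] *)
}.

Definition blank_node (T : Type) : node T :=
  Node (fun=> None) (fun=> 0) (fun=> None).

Definition blank (T : Type) : config T :=
  Config (fun=> None) (fun=> 0) (fun=> None) (fun=> blank_node T) 0.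

(** Convention: destination first.  [PLoad p q f] is [p := q.f] and
    [PStore q f p] is [q.f := p]; likewise for words and elements. *)
Inductive instr :=
  | PNil of nat
  | PNew of nat
  | PMove of nat & nat
  | PLoad of nat & nat & nat
  | PStore of nat & nat & nat
  | WConst of nat & nat
  | WMove of nat & nat
  | WAdd of nat & nat & nat
  | WSub of nat & nat & nat
  | WLoad of nat & nat & nat
  | WStore of nat & nat & nat
  | ENone of nat
  | EMove of nat & nat
  | ELoad of nat & nat & nat
  | EStore of nat & nat & nat
  | Jump of nat
  | JumpPEq of nat & nat & nat
  | JumpWLe of nat & nat & nat.

Definition program := seq instr.

Section Semantics.

Variables (T : Type) (W : nat).
Implicit Types (c : config T) (a : nat).

Definition upd (A : Type) (f : nat -> A) (i : nat) (v : A) : nat -> A :=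
  fun j => if j == i then v else f j.

Definition set_preg c i v :=
  Config (upd (preg c) i v) (wreg c) (ereg c) (heap c) (fresh c).
Definition set_wreg c i v :=
  Config (preg c) (upd (wreg c) i v) (ereg c) (heap c) (fresh c).
Definition set_ereg c i v :=
  Config (preg c) (wreg c) (upd (ereg c) i v) (heap c) (fresh c).
Definition set_node c a nd :=
  Config (preg c) (wreg c) (ereg c) (upd (heap c) a nd) (fresh c).

Definition alloc c p :=
  Config (upd (preg c) p (Some (fresh c))) (wreg c) (ereg c)
         (upd (heap c) (fresh c) (blank_node T)) (fresh c).+1.

Definition set_pfld (nd : node T) f v :=
  Node (upd (pfld nd) f v) (wfld nd) (efld nd).
Definition set_wfld (nd : node T) f v :=
  Node (pfld nd) (upd (wfld nd) f v) (efld nd).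
Definition set_efld (nd : node T) f v :=
  Node (pfld nd) (wfld nd) (upd (efld nd) f v).

(** [None] is a fault: dereferencing nil, or a word exceeding the largest
    machine word [W].  [WSub] is truncated. *)
Definition istep (i : instr) (pc : nat) c : option (nat * config T) :=
  let next c' := Some (pc.+1, c') in
  let deref q k := if preg c q is Some a then next (k a (heap c a)) else None in
  let set_word w v := if v <= W then next (set_wreg c w v) else None in
  match i with
  | PNil p => next (set_preg c p None)
  | PNew p => next (alloc c p)
  | PMove p q => next (set_preg c p (preg c q))
  | PLoad p q f => deref q (fun _ nd => set_preg c p (pfld nd f))
  | PStore q f p => deref q (fun a nd => set_node c a (set_pfld nd f (preg c p)))
  | WConst w v => set_word w v
  | WMove w u => next (set_wreg c w (wreg c u))
  | WAdd w u v => set_word w (wreg c u + wreg c v)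
  | WSub w u v => set_word w (wreg c u - wreg c v)
  | WLoad w q f => deref q (fun _ nd => set_wreg c w (wfld nd f))
  | WStore q f w => deref q (fun a nd => set_node c a (set_wfld nd f (wreg c w)))
  | ENone e => next (set_ereg c e None)
  | EMove e d => next (set_ereg c e (ereg c d))
  | ELoad e q f => deref q (fun _ nd => set_ereg c e (efld nd f))
  | EStore q f e => deref q (fun a nd => set_node c a (set_efld nd f (ereg c e)))
  | Jump l => Some (l, c)
  | JumpPEq p q l => Some (if preg c p == preg c q then l else pc.+1, c)
  | JumpWLe u v l => Some (if wreg c u <= wreg c v then l else pc.+1, c)
  end.

(** [exec P pc c t c']: started at instruction [pc] in configuration [c], [P]
    halts, without fault, after exactly [t] instructions in [c'].  Halting
    means leaving the program. *)
Inductive exec (P : program) : nat -> config T -> nat -> config T -> Prop :=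
  | ExecHalt pc c : size P <= pc -> exec P pc c 0 c
  | ExecStep pc c i pc1 c1 t c2 :
      onth P pc = Some i -> istep i pc c = Some (pc1, c1) ->
      exec P pc1 c1 t c2 -> exec P pc c t.+1 c2.

End Semantics.

(** * Stacks *)

Inductive op (T : Type) := Push of T | Pop | Multipop of nat.
Arguments Pop {T}.
Arguments Multipop {T} _.

Definition apply_op (T : Type) (s : seq T) (o : op T) : seq T :=
  match o with
  | Push x => x :: s
  | Pop => behead s
  | Multipop k => drop k s
  end.

Definition contents (T : Type) (ops : seq (op T)) : seq T :=
  foldl (@apply_op T) [::] ops.

Record stack_impl := StackImpl {
  push_prog : program;
  pop_prog : program;
  multipop_prog : program
}.

Definition prog_of (S : stack_impl) (T : Type) (o : op T) : program :=
  match o with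
  | Push _ => push_prog S
  | Pop => pop_prog S
  | Multipop _ => multipop_prog S
  end.

(** Calling convention: the element argument is passed in element register 0,
    the number argument in word register 0.  All other registers and the whole
    memory persist between operations. *)
Definition pass_arg (T : Type) (o : op T) (c : config T) : config T :=
  match o with
  | Push x => set_ereg c 0 (Some x)
  | Pop => c
  | Multipop k => set_wreg c 0 k
  end.

(** None of the three operations returns a value; what makes a machine state a
    stack is that its top element can be read off, here from element
    register 1 ([None] for the empty stack). *)
Definition top_elem (T : Type) (c : config T) : option T := ereg c 1.

Definition op_exec (S : stack_impl) (T : Type) (W : nat) (c : config T)
    (o : op T) (t : nat) (c' : config T) : Prop :=
  exec W (prog_of S o) 0 (pass_arg o c) t c'.

(** [reach S W ops t c]: performing [ops] in order on the initially empty stack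
    takes total time [t] and leads to [c]. *)
Inductive reach (S : stack_impl) (T : Type) (W : nat) :
    seq (op T) -> nat -> config T -> Prop :=
  | ReachNil : reach S W [::] 0 (blank T)
  | ReachRcons ops t c o t' c' :
      reach S W ops t c -> op_exec S W c o t' c' ->
      reach S W (rcons ops o) (t + t') c'.

(** Word-size assumption: the arguments of MULTIPOP and the number of elements
    in the stack always fit in a machine word. *)
Definition fits (T : Type) (W : nat) (ops : seq (op T)) : Prop :=
  all (fun o => if o is Multipop k then k <= W else true) ops /\
  forall i, size (contents (take i ops)) <= W.

Definition implements_stack (S : stack_impl) : Prop :=
  forall (T : Type) (W : nat) (ops : seq (op T)), fits W ops ->
    (exists t c, reach S W ops t c) /\
    (forall t c, reach S W ops t c -> top_elem c = ohead (contents ops)).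

(** [B n o] bounds the time of every single operation [o] performed on a
    reachable stack with [n] elements. *)
Definition worst_case_time (S : stack_impl)
    (B : forall T : Type, nat -> op T -> nat) : Prop :=
  forall (T : Type) (W : nat) (ops : seq (op T)) (o : op T) t c t' c',
    fits W (rcons ops o) -> reach S W ops t c -> op_exec S W c o t' c' ->
    t' <= B T (size (contents ops)) o.

(** Every operation has amortized time at most [C]. *)
Definition amortized_time (S : stack_impl) (C : nat) : Prop :=
  forall (T : Type) (W : nat) (ops : seq (op T)) t c,
    fits W ops -> reach S W ops t c -> t <= C * size ops.

(** [trunc_log 2 n] is the integer part of the binary logarithm of [n > 0].
    The [maxn 1] only matters when [min (k, log n) = 0], where the time is
    understood to be O(1). *)
Definition stack_bound (C : nat) (T : Type) (n : nat) (o : op T) : nat :=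
  match o with
  | Push _ => C
  | Pop => C
  | Multipop k => C * maxn 1 (minn k (trunc_log 2 n))
  end.

(* Main.v *)
Require Import Defs.
From mathcomp Require Import all_boot zify.

Set Implicit Arguments.
Unset Strict Implicit.
Unset Printing Implicit Defensive.

(** Myers' jump-pointer stack.  Each node stores its height, its parent and one
    jump pointer to a lower node.  The jump lengths follow the skew-binary
    number system: on a push above a node of height [n], the new node jumps
    over the last two jumps from [n] if they have equal length, and to its
    parent otherwise, so a push takes constant time.  MULTIPOP walks down to
    the target height, taking a jump whenever it does not overshoot.  The
    ranks of the jumps strictly increase after the first one, and below the last
    one the walk descends a perfect binary tree, so it makes [O(log n)] moves;
    as each move goes down by at least one, it makes at most [k], which also
    pays for it by the popped elements. *)

(** * Jump heights *)

Definition next_jump (l : seq nat) (n : nat) : nat :=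
  let j := nth 0 l n in let jj := nth 0 l j in
  if n - j == j - jj then jj else n.

(** The jump of [n.+1] depends on the jumps of [n] and of [jmp n]; tabulating all earlier values
    makes this recursion structural. *)
Fixpoint jump_table (n : nat) : seq nat :=
  if n is n'.+1 then rcons (jump_table n') (next_jump (jump_table n') n')
  else [:: 0].

Definition jmp (n : nat) : nat := nth 0 (jump_table n) n.

Lemma size_jump_table n : size (jump_table n) = n.+1.
Proof. by elim: n => //= n IHn; rewrite size_rcons IHn. Qed.

Lemma nth_jump_table n i : i <= n -> nth 0 (jump_table n) i = jmp i.
Proof.
elim: n => [|n IHn]; first by case: i.
rewrite leq_eqVlt => /predU1P[-> //|lt_in].
by rewrite /= nth_rcons size_jump_table lt_in IHn.
Qed.

Lemma jmp0 : jmp 0 = 0. Proof. by []. Qed.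

Lemma jmp_leq n : jmp n <= n.
Proof.
elim/ltn_ind: n => -[//|n] IHn.
rewrite {1}/jmp /= nth_rcons size_jump_table ltnn eqxx /next_jump.
have le_jn := IHn _ (ltnSn n).
rewrite !nth_jump_table //; have := IHn _ (leq_ltn_trans le_jn (ltnSn n)).
by case: eqP; lia.
Qed.

Lemma jmpS n :
  jmp n.+1 = if n - jmp n == jmp n - jmp (jmp n) then jmp (jmp n) else n.
Proof.
rewrite {1}/jmp /= nth_rcons size_jump_table ltnn eqxx /next_jump.
by rewrite !nth_jump_table ?jmp_leq.
Qed.

Lemma jmp_ltn n : 0 < n -> jmp n < n.
Proof.
case: n => // n _; rewrite jmpS.
have := jmp_leq n; have := jmp_leq (jmp n).
by case: eqP; lia.
Qed.

(** At [n = 0] the length test succeeds with [0 = 0], but the target [jmp (jmp 0)] is the parent;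
    hence the guard in [JmpParent]. *)
Variant jmp_spec (n : nat) : nat -> Prop :=
  | JmpParent of (0 < n -> n - jmp n <> jmp n - jmp (jmp n)) : jmp_spec n n
  | JmpMerge of 0 < jmp n & n - jmp n = jmp n - jmp (jmp n) :
      jmp_spec n (jmp (jmp n)).

Lemma jmpP n : jmp_spec n (jmp n.+1).
Proof.
rewrite jmpS; case: eqP => [eq_d|ne_d]; last by left.
case: (posnP n) => [n0|n_gt0]; first by rewrite {1}n0 /= n0; left.
by right=> //; case: (posnP (jmp n)) (jmp_ltn n_gt0) eq_d => // ->; rewrite jmp0; lia.
Qed.

(** Jump lengths from positive heights are skew-binary weights [2 ^ r - 1]; the rank is the exponent
    [r]. *)
Definition rank (n : nat) : nat := trunc_log 2 (n - jmp n).+1.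

(** A merged jump spans two jumps of length [2 ^ r - 1] and one more node: length [2 ^ r.+1 - 1]. *)
Lemma rankE n : 0 < n -> (n - jmp n).+1 = 2 ^ rank n.
Proof.
elim/ltn_ind: n => -[//|n] IHn _; rewrite /rank.
suff [r ->] : exists r, (n.+1 - jmp n.+1).+1 = 2 ^ r by rewrite trunc_expnK.
case: (jmpP n) => [_|j_gt0 eq_d]; first by exists 1; rewrite subSnn.
have n_gt0 : 0 < n := leq_trans j_gt0 (jmp_leq n).
exists (rank n).+1; rewrite expnS -IHn //.
by have := jmp_leq n; have := jmp_leq (jmp n); lia.
Qed.

Lemma rank_gt0 n : 0 < n -> 0 < rank n.
Proof.
move=> n_gt0; have := rankE n_gt0; have := jmp_ltn n_gt0.
by case: (rank n) => //; rewrite expn0; lia.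
Qed.

Lemma rank_leq n R : n < 2 ^ R -> rank n <= R.
Proof.
case: (posnP n) => [->|n_gt0 ltnR]; first by rewrite /rank.
rewrite -(leq_exp2l (m := 2)) // -rankE //; lia.
Qed.

Lemma eq_rank m n : 0 < m -> 0 < n ->
  (m - jmp m = n - jmp n) <-> rank m = rank n.
Proof.
move=> m_gt0 n_gt0; split=> [eq_d|eq_r]; first by rewrite /rank eq_d.
by have := rankE m_gt0; rewrite eq_r -rankE //; lia.
Qed.

Lemma rank_merge n : 0 < jmp n -> n - jmp n = jmp n - jmp (jmp n) ->
  rank n.+1 = (rank n).+1.
Proof.
move=> j_gt0 eq_d; have n_gt0 : 0 < n := leq_trans j_gt0 (jmp_leq n).
apply: (@expnI 2) => //; rewrite expnS -!rankE // jmpS eq_d eqxx.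
by have := jmp_leq n; have := jmp_leq (jmp n); lia.
Qed.

(* The ranks along a chain of jumps are the digit positions of a skew-binary
   number: increasing, except that the two lowest ones may coincide. *)
Lemma rank_jmp n :
  (0 < jmp n -> rank n <= rank (jmp n)) /\
  (0 < jmp (jmp n) -> rank (jmp n) < rank (jmp (jmp n))).
Proof.
elim/ltn_ind: n => -[|n] IHn; first by rewrite !jmp0.
have [IH1 IH2] := IHn n (ltnSn n).
have defr := @rank_merge n; have := rankE (ltn0Sn n).
case: (jmpP n) => [ne_d|j_gt0 eq_d].
  rewrite subSnn => eq_r; have r1 : rank n.+1 = 1.
    by apply: (@expnI 2) => //; rewrite -eq_r.
  rewrite r1; split=> [|j_gt0]; first exact: rank_gt0.
  have n_gt0 : 0 < n := leq_trans j_gt0 (jmp_leq n).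
  (* Equal ranks mean equal lengths, and then the jumps would have been merged. *)
  rewrite ltn_neqAle IH1 // andbT; apply/eqP => /eq_rank-/(_ n_gt0 j_gt0).
  exact: ne_d.
have n_gt0 : 0 < n := leq_trans j_gt0 (jmp_leq n).
rewrite defr // => _; split.
  by rewrite (eq_rank n_gt0 j_gt0).1.
by case: (IHn (jmp n)) => //; rewrite ltnS jmp_leq.
Qed.

(** * Searching along jumps *)

(** Trace of the greedy search from a height down to [m], with its number of moves; each move is one
    iteration of the loop in [multipop_code]. *)
Inductive hops (m : nat) : nat -> nat -> Prop :=
  | HopsDone : hops m m 0
  | HopsJump i t : m < i -> m <= jmp i -> hops m (jmp i) t -> hops m i t.+1
  | HopsParent i t : jmp i.+1 < m -> m <= i -> hops m i t -> hops m i.+1 t.+1.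

Lemma hops_leq m i t : hops m i t -> t + m <= i.
Proof.
elim=> // {}i {}t lt_mi le_mj _ IHt.
by have := @jmp_ltn i; lia.
Qed.

(* The nodes strictly above height [jmp i], up to [i], form a perfect binary
   tree in preorder, with root [i] and children [i.-1] and [jmp i.-1]. *)
Lemma hops_tree R m i : jmp i < m <= i -> i - jmp i < 2 ^ R ->
  exists2 t, hops m i t & t <= 2 * R.
Proof.
elim: R i => [|R IHR] i /andP[lt_jm le_mi]; first by rewrite expn0; lia.
case: (ltngtP m i) le_mi => // [lt_mi _|<- _ _]; last first.
  by exists 0 => //; apply: HopsDone.
case: i => // i in lt_mi lt_jm *; rewrite expnS => lt_d.
case: (jmpP i) (lt_jm) lt_d => [|j_gt0 eq_d lt_jjm lt_d]; first lia.
have [le_ji le_jj] := (jmp_leq i, jmp_leq (jmp i)).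
have [lt_j|le_j] := ltnP (jmp i) m.
  have [||t ht le_t] := IHR i; [lia | lia |].
  by exists t.+1; [apply: HopsParent | lia].
have [||t ht le_t] := IHR (jmp i); [lia | lia |].
(* The second subtree is entered by two moves, to [i] and along its jump; hence the factor 2 per
   level. *)
exists t.+2; last lia.
move: lt_mi; rewrite ltnS leq_eqVlt => /predU1P[eq_mi|lt_mi].
  by have := @jmp_ltn i; lia.
by apply: HopsParent => //; [lia | apply: HopsJump].
Qed.

(** Each jump within the chain raises the rank, which is at most [R], so there are about
    [R - rank i] jumps before the descent of a tree in [2 * R] moves. *)
Lemma hops_chain R m i : m <= i -> 0 < i < 2 ^ R ->
    (0 < jmp i -> rank i < rank (jmp i)) ->
  exists2 t, hops m i t & t + rank i <= 3 * R.
Proof.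
elim/ltn_ind: i => i IHi le_mi /andP[i_gt0 lt_iR] lt_r.
have [r_gt0 le_r] := (rank_gt0 i_gt0, rank_leq lt_iR).
have lt_ji := jmp_ltn i_gt0.
have [lt_jm|le_mj] := ltnP (jmp i) m.
  have [||t ht le_t] := @hops_tree R m i; [lia | lia |].
  by exists t => //; lia.
have [j0|j_gt0] := posnP (jmp i).
  have m0 : m = 0 by lia.
  exists 1; last lia.
  by apply: HopsJump => //; [lia | rewrite j0 m0; apply: HopsDone].
have [||t ht le_t] := IHi _ lt_ji le_mj; first lia.
  by case: (rank_jmp i).
by exists t.+1; [apply: HopsJump => //; lia | have := lt_r j_gt0; lia].
Qed.

(** The first two ranks may tie, so the first jump is counted apart; from [jmp n] on, [hops_chain]
    applies. *)
Lemma hops_log m n : m <= n ->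
  exists2 t, hops m n t & t <= 7 * maxn 1 (trunc_log 2 n).
Proof.
move=> le_mn; set L := trunc_log 2 n.
have lt_nR : n < 2 ^ L.+1 by apply: trunc_log_ltn.
suff [t ht le_t] : exists2 t, hops m n t & t <= 3 * L.+1 + 1.
  by exists t => //; lia.
have [lt_jm|le_mj] := ltnP (jmp n) m.
  have [||t ht le_t] := @hops_tree L.+1 m n; [lia | lia |].
  by exists t => //; lia.
move: le_mn; rewrite leq_eqVlt => /predU1P[->|lt_mn].
  by exists 0 => //; apply: HopsDone.
have lt_jn : jmp n < n by apply: jmp_ltn; lia.
have [j0|j_gt0] := posnP (jmp n).
  have m0 : m = 0 by lia.
  by exists 1; [apply: HopsJump => //; rewrite j0 m0; apply: HopsDone | lia].
have [||t ht le_t] := @hops_chain L.+1 m (jmp n) le_mj; first lia.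
  by case: (rank_jmp n).
by exists t.+1; [apply: HopsJump | lia].
Qed.

(** * Programs *)

(* Pointer register 0 holds the top node, or nil before the first push.  In a
   node, pointer fields 0 and 1 are the parent and the jump pointer, word field
   0 is the height and element field 0 the element; the root, of height 0, has
   no element and is its own parent and jump target. *)
Definition push_code : program :=
  [:: PNil 2; JumpPEq 0 2 3; Jump 6;
      PNew 0; PStore 0 0 0; PStore 0 1 0;
      WLoad 1 0 0; PLoad 1 0 1; WLoad 2 1 0; PLoad 2 1 1; WLoad 3 2 0;
      WSub 4 1 2; WSub 5 2 3;
      PNew 3; PStore 3 0 0;
      JumpWLe 4 5 17; Jump 18; JumpWLe 5 4 19; PMove 2 0; PStore 3 1 2;
      EStore 3 0 0; EMove 1 0; WConst 2 1; WAdd 1 1 2; WStore 3 0 1;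
      PMove 0 3].

Definition pop_code : program :=
  [:: PNil 2; JumpPEq 0 2 4; PLoad 0 0 0; ELoad 1 0 0].

Definition multipop_code : program :=
  [:: PNil 2; JumpPEq 0 2 13; WLoad 1 0 0; WSub 1 1 0;
      WLoad 2 0 0; JumpWLe 2 1 12; PLoad 1 0 1; WLoad 3 1 0;
      JumpWLe 1 3 10; PLoad 1 0 0; PMove 0 1; Jump 4;
      ELoad 1 0 0].

Definition jump_stack : stack_impl :=
  StackImpl push_code pop_code multipop_code.

(** Determinism transfers the bounds shown for one constructed run to every run. *)
Lemma exec_inj (T : Type) W P pc (c : config T) t1 c1 t2 c2 :
  exec W P pc c t1 c1 -> exec W P pc c t2 c2 -> t1 = t2 /\ c1 = c2.
Proof.
move=> ex1; elim: ex1 t2 c2 => {pc c t1 c1} [pc c le_pc|pc c i pc1 c1 t c' Pi st _ IH] t2 c2 ex2.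
  case: ex2 le_pc => // {}pc {}c i pc1 c1 t c' Pi _ _ le_pc.
  by move: Pi; rewrite onth_default.
case: ex2 Pi st IH => [{}pc {}c le_pc|{}pc {}c i' pc1' c1' t' c'' -> st' ex' [<-]].
  by rewrite onth_default.
by rewrite st' => -[<- <-] IH; have [-> ->] := IH _ _ ex'.
Qed.

(** * Memory invariant *)

Section Invariant.

Variable T : Type.
Implicit Types (c : config T) (s : seq T).

(** [A] gives the address of the node at each height. Heights count from the bottom, so popping
    leaves the remaining nodes unchanged. *)
Definition good_node (A : nat -> nat) s c i : Prop :=
  let nd := heap c (A i) in
  [/\ A i < fresh c, wfld nd 0 = i, pfld nd 0 = Some (A i.-1),
      pfld nd 1 = Some (A (jmp i)) & efld nd 0 = ohead (drop (size s - i) s)].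

Definition layout (A : nat -> nat) s c : Prop :=
  preg c 0 = Some (A (size s)) /\ forall i, i <= size s -> good_node A s c i.

Definition stack_inv s c : Prop :=
  ereg c 1 = ohead s /\
  ((preg c 0 = None /\ s = [::]) \/ exists A, layout A s c).

Lemma good_node_drop A s c c' k i : heap c' = heap c -> fresh c' = fresh c ->
  i <= size s - k -> good_node A s c i -> good_node A (drop k s) c' i.
Proof.
rewrite /good_node => -> -> le_i [? ? ? ? ->]; split=> //.
rewrite size_drop drop_drop; case: (leqP k (size s)) => le_k.
  by congr (ohead (drop _ s)); lia.
by rewrite !drop_oversize //; lia.
Qed.

End Invariant.

(* Symbolic execution of the three programs *)
Tactic Notation "step" tactic(tac) :=
  apply: ExecStep; [reflexivity | rewrite /= /upd /=; tac; reflexivity | ].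

(** A jump costs 7 instructions, a parent move 8, and the exit 3. *)
Lemma multipop_loop (T : Type) W A (s : seq T) m i t : hops m i t ->
    forall c, i <= size s -> (forall j, j <= size s -> good_node A s c j) ->
    preg c 0 = Some (A i) -> wreg c 1 = m ->
  exists t' c', [/\ exec W multipop_code 4 c t' c', t' <= 8 * t + 3,
    preg c' 0 = Some (A m), heap c' = heap c & fresh c' = fresh c] /\
    ereg c' 1 = efld (heap c (A m)) 0.
Proof.
elim=> {i t} [|i t lt_mi le_mj _ IH|i t lt_jm le_mi _ IH] c le_i good p0 w1.
- have [_ wi _ _ _] := good _ le_i.
  exists 3, (set_ereg (set_wreg c 2 m) 1 (efld (heap c (A m)) 0)).
  split=> //; split=> //.
  step (rewrite p0 wi).
  step (rewrite w1 leqnn).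
  step (rewrite p0).
  exact: ExecHalt.
- have [_ wi _ pi _] := good _ le_i.
  have le_j : jmp i <= size s by apply: leq_trans le_i; apply: jmp_leq.
  have [_ wj _ _ _] := good _ le_j.
  pose c1 := set_preg (set_wreg (set_preg (set_wreg c 2 i) 1 (Some (A (jmp i)))) 3 (jmp i)) 0 (Some (A (jmp i))).
  have [||||t' [c' [[ex le_t p0' hc' fc'] ec']]] := IH c1 => //.
  exists (7 + t'), c'; split=> //; split=> //; last lia.
  step (rewrite p0 wi).
  step (rewrite w1 leqNgt lt_mi).
  step (rewrite p0 pi).
  step (rewrite wj).
  step (rewrite w1 le_mj).
  step idtac.
  step idtac.
  exact: ex.
- have [_ wi pi pj _] := good _ le_i.
  have le_j : jmp i.+1 <= size s by apply: leq_trans le_i; apply: jmp_leq.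
  have [_ wj _ _ _] := good _ le_j.
  pose c1 := set_preg (set_preg (set_wreg (set_preg (set_wreg c 2 i.+1) 1 (Some (A (jmp i.+1)))) 3 (jmp i.+1)) 1 (Some (A i))) 0 (Some (A i)).
  have [||||t' [c' [[ex le_t p0' hc' fc'] ec']]] := IH c1 => //; first exact: ltnW.
  exists (8 + t'), c'; split=> //; split=> //; last lia.
  step (rewrite p0 wi).
  step (rewrite w1 leqNgt ltnS le_mi).
  step (rewrite p0 pj).
  step (rewrite wj).
  step (rewrite w1 leqNgt lt_jm).
  step (rewrite p0 pi).
  step idtac.
  step idtac.
  exact: ex.
Qed.

(** [exec] describes only halting runs, so a run fragment is expressed by prepending it to any
    halting continuation. *)
Definition leads (T : Type) W P k pc (c : config T) pc' c' : Prop :=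
  forall t cf, exec W P pc' c' t cf -> exec W P pc c (k + t) cf.

Lemma push_read (T : Type) W A (s : seq T) c (n := size s) :
    layout A s c -> n <= W ->
  exists c', leads W push_code 7 6 c 13 c' /\
    [/\ heap c' = heap c, fresh c' = fresh c, preg c' 0 = Some (A n) &
        ereg c' 0 = ereg c 0] /\
    [/\ preg c' 2 = Some (A (jmp (jmp n))), wreg c' 1 = n,
        wreg c' 4 = n - jmp n & wreg c' 5 = jmp n - jmp (jmp n)].
Proof.
move=> [p0 good] le_nW.
have le_jn : jmp n <= n := jmp_leq n.
have le_jjn : jmp (jmp n) <= n := leq_trans (jmp_leq _) le_jn.
have [_ w0 _ q1 _] := good _ (leqnn n).
have [_ w1 _ qq1 _] := good _ le_jn.
have [_ w2 _ _ _] := good _ le_jjn.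
eexists; split.
  move=> t cf ex.
  step (rewrite p0 w0).
  step (rewrite p0 q1).
  step (rewrite w1).
  step (rewrite qq1).
  step (rewrite w2).
  step (rewrite (leq_trans (leq_subr _ _) le_nW)).
  step (rewrite (leq_trans (leq_subr _ _) (leq_trans le_jn le_nW))).
  exact: ex.
by [].
Qed.

Lemma push_link (T : Type) W (c : config T) (a := fresh c) :
  exists k c', k <= 6 /\ leads W push_code k 13 c 20 c' /\
    [/\ fresh c' = a.+1, wreg c' 1 = wreg c 1, ereg c' 0 = ereg c 0 &
        preg c' 3 = Some a] /\
    [/\ forall b, b < a -> heap c' b = heap c b,
        pfld (heap c' a) 0 = preg c 0 &
        pfld (heap c' a) 1 =
          if wreg c 4 == wreg c 5 then preg c 2 else preg c 0].
Proof.
have neqa b : b < fresh c -> (b == fresh c) = false by move/ltn_eqF.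
(* The program tests equality by two comparisons, one in each direction. *)
case: (ltngtP (wreg c 4) (wreg c 5)) => cmp.
- exists 6; eexists; split=> //; split.
    move=> t cf ex.
    step idtac.
    step idtac.
    step (rewrite (ltnW cmp)).
    step (rewrite leqNgt cmp).
    step idtac.
    step idtac.
    exact: ex.
  by split; split=> // [b /neqa nb||]; rewrite /= /upd /=;
    [rewrite nb | rewrite !eqxx | rewrite !eqxx].
- exists 6; eexists; split=> //; split.
    move=> t cf ex.
    step idtac.
    step idtac.
    step (rewrite leqNgt cmp).
    step idtac.
    step idtac.
    step idtac.
    exact: ex.
  by split; split=> // [b /neqa nb||]; rewrite /= /upd /=;
    [rewrite nb | rewrite !eqxx | rewrite !eqxx].
- exists 5; eexists; split=> //; split.
    move=> t cf ex.
    step idtac.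
    step idtac.
    step (rewrite cmp leqnn).
    step (rewrite ?cmp leqnn).
    step idtac.
    exact: ex.
  by split; split=> // [b /neqa nb||]; rewrite /= /upd /=;
    [rewrite nb | rewrite !eqxx | rewrite !eqxx].
Qed.

Lemma push_write (T : Type) W (c : config T) a (n := wreg c 1) :
    preg c 3 = Some a -> n < W ->
  exists c', exec W push_code 20 c 6 c' /\
    [/\ fresh c' = fresh c, preg c' 0 = Some a, ereg c' 1 = ereg c 0 &
        forall b, b != a -> heap c' b = heap c b] /\
    [/\ wfld (heap c' a) 0 = n.+1, efld (heap c' a) 0 = ereg c 0 &
        pfld (heap c' a) = pfld (heap c a)].
Proof.
move=> p3 lt_nW; eexists; split.
  step (rewrite p3).
  step idtac.
  step (rewrite (leq_ltn_trans (leq0n _) lt_nW)).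
  step (rewrite addn1 -/n lt_nW).
  step (rewrite p3).
  step (rewrite p3).
  exact: ExecHalt.
by split; split=> //; rewrite /= /upd /= ?eqxx // => b /negPf ->.
Qed.

Lemma push_body (T : Type) W A (s : seq T) c x :
    layout A s c -> ereg c 0 = Some x -> size s < W ->
  exists t c', [/\ exec W push_code 6 c t c', t <= 19 & stack_inv (x :: s) c'].
Proof.
set n := size s => lay e0 lt_nW.
have [c1 [l1 [[h1 f1 p0 e1] [p2 w1 w4 w5]]]] := push_read lay (ltnW lt_nW).
have [k [c2 [le_k [l2 [[f2 w2 e2 p3] [h2 q0 q1]]]]]] := push_link W c1.
have [|c' [ex [[f3 p0' e3 h3] [wn en qn]]]] := push_write p3 (W := W).
  by rewrite w2 w1.
exists (7 + (k + 6)), c'; split; [exact/l1/l2 | lia | split].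
  by rewrite e3 e2 e1 e0.
case: lay => _ good.
right; exists (upd A n.+1 (fresh c)); split; first by rewrite p0' f1 /upd eqxx.
move=> i; rewrite leq_eqVlt => /predU1P[->|/= lt_in].
  have := jmp_ltn (ltn0Sn n); rewrite /good_node /upd /= eqxx => lt_j.
  rewrite subnn !ltn_eqF // -f1 wn w2 w1 qn q0 q1 en e2 e1 f3 f2 p0 e0.
  by rewrite w4 w5 p2 jmpS; case: eqP; split.
have le_ji : jmp i <= i := jmp_leq i.
have [ltAi wi pi qi ei] := good _ lt_in.
rewrite /good_node /upd !ltn_eqF; try (by rewrite -/n; lia).
rewrite h3 ?neq_ltn ?h2 ?f1 ?ltAi // h1 f3 f2 f1.
by split=> //=; [lia | rewrite subSn // ei].
Qed.

Lemma push_spec (T : Type) W (s : seq T) c x : stack_inv s c -> size s < W ->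
  exists t c', [/\ exec W push_code 0 (set_ereg c 0 (Some x)) t c', t <= 25 &
                   stack_inv (x :: s) c'].
Proof.
move=> [_ [[p0 ->]|[A lay]]] lt_nW.
  pose c1 := set_preg (set_ereg c 0 (Some x)) 2 None; pose a := fresh c.
  pose root := set_pfld (set_pfld (blank_node T) 0 (Some a)) 1 (Some a).
  pose c2 := set_node (set_node (alloc c1 0) a
    (set_pfld (blank_node T) 0 (Some a))) a root.
  (* Only height 0 occurs in the empty stack, so a constant address map suffices. *)
  have lay : layout (fun=> a) [::] c2.
    by split=> // -[] // _; rewrite /good_node /= /upd eqxx; split.
  have [t [c' [ex le_t inv]]] := push_body lay erefl lt_nW.
  exists (5 + t), c'; split=> //; last lia.
  step idtac.
  step (rewrite p0).
  step idtac.
  step idtac.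
  step idtac.
  by move: ex; rewrite /c2 /root /upd /= eqxx.
have [t [c' [ex le_t inv]]] := @push_body T W A s
  (set_preg (set_ereg c 0 (Some x)) 2 None) x lay erefl lt_nW.
exists (3 + t), c'; split=> //; last lia.
step idtac.
step (rewrite lay.1).
step idtac.
exact: ex.
Qed.

(** If the root is on top, its self-loop keeps it there, and its missing element signals
    emptiness. *)
Lemma pop_spec (T : Type) W (s : seq T) c : stack_inv s c ->
  exists t c', [/\ exec W pop_code 0 c t c', t <= 4 & stack_inv (behead s) c'].
Proof.
move=> [e1 [[p0 s0]|[A [p0 good]]]].
  exists 2; eexists; split=> //.
    step idtac.
    step (rewrite p0).
    exact: ExecHalt.
  by rewrite s0; split; [rewrite /= e1 s0 | left].
have [_ _ p _ _] := good _ (leqnn _).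
exists 4; eexists; split=> //.
  step idtac.
  step (rewrite p0).
  step (rewrite p0 p).
  step idtac.
  exact: ExecHalt.
rewrite -drop1; have le_m : (size s).-1 <= size s by lia.
have eq_m : size s - 1 = (size s).-1 by lia.
have [_ _ _ _ e] := good _ le_m.
split; last right.
  by rewrite /= e; case: (s) => // y s'; rewrite subSnn.
exists A; split; first by rewrite size_drop eq_m.
rewrite size_drop => i le_i; apply: good_node_drop (good i _) => //; lia.
Qed.

Lemma multipop_spec (T : Type) W (s : seq T) c k : stack_inv s c -> size s <= W ->
  exists t c' h, [/\ exec W multipop_code 0 (set_wreg c 0 k) t c', t <= 8 * h + 7,
    h <= size s - size (drop k s) /\ h <= 7 * maxn 1 (trunc_log 2 (size s)) &
    stack_inv (drop k s) c'].
Proof.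
move=> [e1 [[p0 s0]|[A [p0 good]]]] le_nW.
  exists 2; eexists; exists 0; split=> //.
    step idtac.
    step (rewrite p0).
    exact: ExecHalt.
  by rewrite s0; split; [rewrite /= e1 s0 | left].
have [_ w _ _ _] := good _ (leqnn _).
(* Truncated subtraction sends the search to the root when [k] exceeds the size. *)
set m := size s - k; have le_m : m <= size s := leq_subr _ _.
have [h hop le_h] := hops_log le_m.
pose c1 := set_wreg (set_wreg (set_preg (set_wreg c 0 k) 2 None) 1 (size s)) 1 m.
have [t [c' [[ex le_t p0' h' f'] e']]] :=
  @multipop_loop T W A s _ _ _ hop c1 (leqnn _) good p0 erefl.
exists (4 + t), c', h; split.
- step idtac.
  step (rewrite p0).
  step (rewrite p0 w).
  step (rewrite (leq_trans le_m le_nW)).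
  exact: ex.
- lia.
- by split=> //; rewrite size_drop -/m; have := hops_leq hop; lia.
have [_ _ _ _ em] := good _ le_m.
have dm : drop (size s - m) s = drop k s.
  rewrite /m; case: (leqP k (size s)) => le_k; first by rewrite subKn.
  by rewrite !drop_oversize //; lia.
split; first by rewrite e' /= em dm.
right; exists A; split; first by rewrite size_drop.
by rewrite size_drop => i le_i; apply: good_node_drop (good i _) => //; lia.
Qed.

(* [8 * size s] is the potential: the search makes at most one move per popped
   element, and a move takes at most 8 instructions. *)
Lemma op_spec (T : Type) W (s : seq T) c (o : op T) : stack_inv s c ->
    size s <= W -> size (apply_op s o) <= W ->
  exists t c', op_exec jump_stack W c o t c' /\
    [/\ t <= stack_bound 63 (size s) o,
        t + 8 * size (apply_op s o) <= 33 + 8 * size s &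
        stack_inv (apply_op s o) c'].
Proof.
rewrite /op_exec; case: o => [x||k] inv le_W /= le_W'.
- have [t [c' [ex le_t inv']]] := push_spec x inv le_W'.
  (* At most 25 instructions plus a potential increase of 8 give 33. *)
  by exists t, c'; split=> //; split=> //; lia.
- have [t [c' [ex le_t inv']]] := pop_spec W inv.
  by exists t, c'; split=> //; split=> //; rewrite ?size_behead; lia.
have [t [c' [h [ex le_t [le_h1 le_h2] inv']]]] := multipop_spec k inv le_W.
exists t, c'; split=> //; rewrite size_drop in le_h1 *; split=> //; last lia.
have {}le_h1 : h <= k by lia.
(* The bound [k] or the logarithmic one is used, whichever attains the minimum; then [8 * h + 7] is
   at most [8 * 7 + 7 = 63] times the maximum. *)
have : h <= 7 * maxn 1 (minn k (trunc_log 2 (size s))) by lia.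
lia.
Qed.

(** * Sequences of operations *)

Lemma fits_rcons (T : Type) W ops (o : op T) : fits W (rcons ops o) ->
  [/\ fits W ops, size (contents ops) <= W &
      size (apply_op (contents ops) o) <= W].
Proof.
rewrite /fits all_rcons => -[/andP[_ fa] fs].
have fi i : i <= size ops -> size (contents (take i ops)) <= W.
  move=> le_i; have := fs i; rewrite -cats1 takel_cat //.
split.
- split=> // i; case: (leqP i (size ops)) => [|/ltnW le_i]; first exact: fi.
  by rewrite take_oversize // -[ops]take_size fi.
- by rewrite -[ops]take_size fi.
by have := fs (size ops).+1; rewrite take_oversize ?size_rcons // /contents foldl_rcons.
Qed.

(** The amortized bounds telescope, the potential being 0 initially. *)
Lemma reach_inv (T : Type) W (ops : seq (op T)) t c : fits W ops ->
    reach jump_stack W ops t c ->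
  stack_inv (contents ops) c /\ t + 8 * size (contents ops) <= 33 * size ops.
Proof.
move=> fit r; elim: r fit => {ops t c} [_|ops t c o t' c' _ IH ex].
  by split=> //; split=> //; left.
move=> /fits_rcons[fit le_W le_W']; have [inv le_t] := IH fit.
have [t1 [c1 [ex1 [_ le_t1 inv1]]]] := op_spec inv le_W le_W'.
have [-> ->] := exec_inj ex ex1.
by rewrite /contents foldl_rcons size_rcons -/(contents ops); split=> //; lia.
Qed.

Lemma reach_exists (T : Type) W (ops : seq (op T)) : fits W ops ->
  exists t c, reach jump_stack W ops t c.
Proof.
elim/last_ind: ops => [_|ops o IH]; first by do 2 eexists; apply: ReachNil.
move=> /fits_rcons[fit le_W le_W']; have [t [c r]] := IH fit.
have [inv _] := reach_inv fit r.
have [t' [c' [ex _]]] := op_spec inv le_W le_W'.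
by exists (t + t'), c'; apply: ReachRcons r ex.
Qed.

Theorem theorem3 :
  exists S : stack_impl,
    implements_stack S /\
    exists C : nat, worst_case_time S (stack_bound C) /\ amortized_time S C.
Proof.
exists jump_stack; split.
  move=> T W ops fit; split; first exact: reach_exists.
  by move=> t c /(reach_inv fit)[[]].
(* [63] is the worst-case constant and exceeds the amortized cost 33. *)
exists 63; split.
  move=> T W ops o t c t' c' /fits_rcons[fit le_W le_W'] r ex.
  have [inv _] := reach_inv fit r.
  have [t1 [c1 [ex1 [le_t _ _]]]] := op_spec inv le_W le_W'.
  by have [-> _] := exec_inj ex ex1.
by move=> T W ops t c fit /(reach_inv fit)[_]; lia.
Qed.
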